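(* Let $\mathcal{I}=[0,\bar z]$ with $\bar z>0$, let $f_0\in L^\infty(\mathcal{I})$ be a probability density ($f_0\ge0$, $\int_{\mathcal{I}}f_0\,dz=1$), and let $f\ge 0$ be a solution for all $t\ge 0$ of $$\partial_t f(z,t)=-\alpha(z,t)f(z,t)\int_z^{\bar z}f(y,t)\,dy+f(z,t)\int_0^z\alpha(y,t)f(y,t)\,dy,\qquad f(z,0)=f_0(z),$$ for a given learning function $\alpha=\alpha(z,t)$ with values in $[0,1]$. Suppose there is a constant $\underline\alpha$ such that $\alpha(z,t)\ge\underline\alpha>0$ for all $z,t$, and that $\bar z\in\operatorname{supp}(f(\cdot,t))$ for all $t\ge 0$. Then $$f(\cdot,t)\rightharpoonup^*\delta_{\bar z}\qquad\text{as } t\to\infty,$$ where $\delta_{\bar z}$ is the Dirac measure at $\bar z$.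
   Context: Weak-$*$ convergence is that of measures on $[0,\bar z]$, i.e. $\int_{\mathcal{I}}g(z)f(z,t)\,dz\to g(\bar z)$ for every $g\in C([0,\bar z])$. The support of a function in $L^1(\mathcal{I})$ is its essential support. *)

(* Defs.v *)
From HB Require Import structures.
From mathcomp Require Import all_boot all_order all_algebra.
From mathcomp Require Import all_classical all_reals all_analysis.

Set Implicit Arguments.
Unset Strict Implicit.
Unset Printing Implicit Defensive.

Import Order.TTheory GRing.Theory Num.Theory.
Import numFieldNormedType.Exports.

Local Open Scope classical_set_scope.
Local Open Scope ring_scope.

Notation mu := lebesgue_measure.

Definition absolutely_continuous (R : realType) (a b : R) (g : R -> R) : Prop :=
  forall e : R, 0 < e -> exists2 d : R, 0 < d &
    forall (n : nat) (J : 'I_n -> R * R),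
      (forall i, a <= (J i).1 /\ (J i).1 <= (J i).2 /\ (J i).2 <= b) ->
      trivIset [set: 'I_n] (fun i => `](J i).1, (J i).2[%classic) ->
      \sum_(i < n) ((J i).2 - (J i).1) < d ->
      \sum_(i < n) `|g (J i).2 - g (J i).1| < e.

(* The complement, within D, of the largest open set on which g vanishes
   almost everywhere. *)
Definition ess_support (R : realType) (D : set R) (g : R -> R) : set R :=
  D `\` \bigcup_(U in [set U | open U /\
                   {ae mu, forall x : R, D x -> U x -> g x = 0}]) U.

(* f z t stands for f(z, t), with only z in [0, zbar] and t >= 0 relevant. *)
Definition rhs (R : realType) (zbar : R) (alpha f : R -> R -> R) (z t : R) : R :=
  - alpha z t * f z t * (\int[mu]_(y in `[z, zbar]) f y t)
  + f z t * (\int[mu]_(y in `[0, z]) (alpha y t * f y t)).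

Record learning_function (R : realType) (zbar : R) (alpha : R -> R -> R) :
    Prop := LearningFunction {
  lf_measurable : measurable_fun
    (`[0, zbar]%classic `*` `[0, +oo[%classic : set (R * R))
    (fun p : R * R => alpha p.1 p.2);
  lf_range : forall z t : R, z \in `[0, zbar] -> 0 <= t ->
    0 <= alpha z t /\ alpha z t <= 1
}.

(* Solutions in the sense of Caratheodory: since alpha is only measurable in
   time, the equation cannot be asked to hold at every t; it holds for almost
   every z, at almost every t > 0, along a trajectory f(z, -) that is locally
   absolutely continuous. The solution class is that of
   L^oo_loc([0, +oo); L^1(0, zbar)). *)
Record is_solution (R : realType) (zbar : R) (alpha f : R -> R -> R)
    (f0 : R -> R) : Prop := IsSolution {
  sol_measurable : measurable_fun
    (`[0, zbar]%classic `*` `[0, +oo[%classic : set (R * R))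
    (fun p : R * R => f p.1 p.2);
  sol_integrable : forall t : R, 0 <= t ->
    mu.-integrable `[0, zbar] (fun z => (f z t)%:E);
  sol_bounded : forall T : R, exists C : R, forall t : R, 0 <= t -> t <= T ->
    \int[mu]_(z in `[0, zbar]) `|f z t| <= C;
  sol_abscont : {ae mu, forall z : R, z \in `[0, zbar] ->
    forall T : R, 0 < T -> absolutely_continuous 0 T (f z)};
  sol_eq : {ae mu, forall z : R, z \in `[0, zbar] ->
    {ae mu, forall t : R, 0 < t -> is_derive t 1 (f z) (rhs zbar alpha f z t)}};
  sol_init : {ae mu, forall z : R, z \in `[0, zbar] -> f z 0 = f0 z}
}.

Record bounded_density (R : realType) (zbar : R) (f0 : R -> R) : Prop :=
    BoundedDensity {
  bd_Linfty : f0 \_ `[0, zbar] \in Lfun mu +oo%E;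
  bd_ge0 : {ae mu, forall z : R, z \in `[0, zbar] -> 0 <= f0 z};
  bd_mass : (\int[mu]_(z in `[0%R, zbar]) (f0 z)%:E = 1)%E
}.

(* Weak-* convergence, as t --> +oo, of the measures f(z, t) dz on [0, zbar]. *)
Definition weak_star_cvg (R : realType) (zbar : R) (f : R -> R -> R)
    (nu : {measure set (measurableTypeR R) -> \bar R}) : Prop :=
  forall g : R -> R, {within `[0, zbar], continuous g} ->
    \int[mu]_(z in `[0, zbar]) (g z * f z t) @[t --> +oo] -->
    \int[nu]_(z in `[0, zbar]) g z.

(* Main.v *)
Require Import Defs.
From HB Require Import structures.
From mathcomp Require Import all_boot all_order all_algebra.
From mathcomp Require Import all_classical all_reals all_analysis.
From mathcomp Require Import measurable_realfun.
From mathcomp Require Import ring lra.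

(** The proof follows the mass X(t) = \int_0^c f(z,t) dz lying below a fixed
    level c < zbar.

    Encounters only move mass upwards.  Integrating the equation over z in
    [0,c], the exchanges between two points of [0,c] cancel, because
      \int_0^c u(z) \int_0^z v(y) dy dz = \int_0^c v(y) \int_y^c u(z) dz dy,
    and only the flux out of [0,c] remains (integral_pairwise_exchange):
      X' = - (\int_0^c alpha f) (\int_c^zbar f).
    As the equation holds only almost everywhere in time along absolutely
    continuous trajectories, this is established in integrated form
    (mass_balance).  It needs the fundamental theorem of calculus for
    absolutely continuous functions (absolutely_continuous_FTC) for almost
    every z, and Fubini's theorem to exchange the integrals in z and in time;
    the latter is legitimate since the right-hand side is bounded by
    2 ||f(.,t)||_1 |f(z,t)| (normr_rhs_le, integrable_rhs).

    For c = zbar the flux vanishes, so the mass stays equal to 1 (total_mass).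
    For c < zbar, X is nonincreasing, hence the mass above c never falls below
    its initial value m, which is positive because zbar is in the essential
    support at time 0 (ess_support_tail_gt0).  With alpha >= alow, the flux at
    any time before t is at least alow X(t) m, and so
      X(t) (1 + alow m t) <= X(0) <= 1
    (mass_below_decay), which forces X(t) to tend to 0.  A family of
    probability densities on [0,zbar] that leaves every [0,c] with c < zbar
    concentrates at zbar (concentration_weak_star). *)

Set Implicit Arguments.
Unset Strict Implicit.
Unset Printing Implicit Defensive.

Import Order.TTheory GRing.Theory Num.Theory.
Import numFieldNormedType.Exports.

Local Open Scope classical_set_scope.
Local Open Scope ring_scope.

#[local] Instance lebesgue_ae_filter (R : realType) :
  Filter (almost_everywhere (@lebesgue_measure R)).
Proof. exact: ae_filter_ringOfSetsType. Qed.

(** * The fundamental theorem of calculus for absolutely continuous functions *)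

(** Induction along a segment: a property that can be pushed across every point
    reaches the right end, since the supremum of the points reached so far can
    itself be crossed. *)
Lemma interval_induction (R : realType) (a b : R) (Q : R -> Prop) :
  a <= b -> Q a ->
  (forall x, a <= x <= b -> exists2 d, 0 < d &
    forall u v, a <= u <= x -> x <= v <= b -> x - d < u -> v < x + d ->
      Q u -> Q v) ->
  Q b.
Proof.
move=> ab Qa step.
pose S := [set x | a <= x <= b /\ Q x].
have Sa : S a by rewrite /S /= lexx ab.
have Sb : ubound S b by move=> x [/andP[]].
have supS : has_sup S by split; [exists a | exists b].
have supab : a <= sup S <= b.
  apply/andP; split; first by apply: ub_le_sup => //; exists b.
  by apply: ge_sup => //; exists a.
have [d d0 stepd] := step _ supab.
have [u [/andP[au ub] Qu] du] := sup_adherent d0 supS.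
have us : u <= sup S by apply: ub_le_sup; [exists b | split => //; rewrite au ub].
(* v lies beyond the supremum, unless the supremum is b. *)
pose v := Num.min b (sup S + d / 2).
have [sa sb] := andP supab.
have sv : sup S <= v by rewrite le_min sb lerDl divr_ge0// ltW.
have vd : v < sup S + d.
  by rewrite gt_min; apply/orP; right; lra.
have vb : v <= b by rewrite ge_min lexx.
have Qv : Q v by apply: (stepd u v) => //; rewrite ?au ?sv.
have : v <= sup S.
  apply: ub_le_sup; first by exists b.
  by split => //; rewrite vb andbT (le_trans sa).
rewrite /v ge_min => /orP[bs|]; last first.
  by rewrite gerDl pmulr_lle0 ?invr_gt0// leNgt d0.
by have <- : v = b by apply/le_anti; rewrite vb (le_trans bs sv).
Qed.

(** Only intervals that contain x are controlled, which is what differentiability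
    at the single point x can give. *)
Lemma derive_ge0_increment (R : realType) (h : R -> R) (x l e : R) :
  0 <= l -> is_derive x 1 h l -> 0 < e ->
  exists2 d, 0 < d & forall u v, u <= x -> x <= v -> x - d < u -> v < x + d ->
    h u - h v <= e * (v - u).
Proof.
move=> l0 [hx hl] e0.
have : k^-1 *: (h (k *: 1 + x) - h x) @[k --> 0^'] --> l.
  by move: hx; rewrite -hl; apply.
move=> /cvgrPdist_lt/(_ _ e0) [d /= d0 dP].
have slope k : `|k| < d -> k != 0 -> - e < k^-1 * (h (k + x) - h x).
  move=> kd k0; have /= := dP k; rewrite sub0r normrN => /(_ kd k0).
  rewrite /GRing.scale/= mulr1 ltr_norml => /andP[_].
  by move: (_ * (_ - _)) => w; lra.
exists d => // u v ux xv du vd.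
have hv : h x - h v <= e * (v - x).
  have [->|vx] := eqVneq v x; first by rewrite !subrr mulr0.
  have vx0 : 0 < v - x by rewrite subr_gt0 lt_neqAle eq_sym vx.
  have := slope (v - x); rewrite gtr0_norm// subrK gt_eqF// => /(_ _ isT).
  have -> : v - x < d by lra.
  by move=> /(_ isT); rewrite ltrNl -mulrN opprB mulrC ltr_pdivrMr// => /ltW.
have hu : h u - h x <= e * (x - u).
  have [->|xu] := eqVneq u x; first by rewrite !subrr mulr0.
  have xu0 : 0 < x - u by rewrite subr_gt0 lt_neqAle xu.
  have ux0 : u - x < 0 by lra.
  have := slope (u - x); rewrite ltr0_norm// subrK lt_eqF// opprB.
  have -> : x - u < d by lra.
  move=> /(_ isT isT); rewrite ltrNl -mulNr -invrN opprB.
  by rewrite mulrC ltr_pdivrMr// => /ltW.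
have -> : h u - h v = (h u - h x) + (h x - h v) by ring.
have -> : e * (v - u) = e * (x - u) + e * (v - x) by ring.
exact: lerD.
Qed.

Lemma lebesgue_measure_bigsetU_itv (R : realType) n (J : 'I_n -> R * R) :
  (forall i, (J i).1 <= (J i).2) ->
  trivIset [set: 'I_n] (fun i => `](J i).1, (J i).2[%classic) ->
  mu (\big[setU/set0]_(i < n) `](J i).1, (J i).2[%classic) =
  (\sum_(i < n) ((J i).2 - (J i).1))%:E.
Proof.
move=> J12 tJ; rewrite [LHS]measure_bigsetU_ord// -sumEFin.
apply: eq_bigr => i _; rewrite [LHS]lebesgue_measure_itv/= lte_fin EFinB.
by case: ltP => // ij; have -> : (J i).1 = (J i).2;
  [apply/le_anti; rewrite ij J12 | rewrite subee].
Qed.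

(** Absolute continuity restated for lists of intervals that can be extended at
    the head, the total length being controlled by the measure of a set that
    contains all of them. *)
Lemma absolutely_continuous_seq (R : realType) (a b : R) (g : R -> R) :
  absolutely_continuous a b g -> forall e, 0 < e -> exists2 d, 0 < d &
  forall (s : seq (R * R)) (U : set R), measurable U -> (mu U < d%:E)%E ->
    all (fun p => [&& a <= p.1, p.1 <= p.2 & p.2 <= b]) s ->
    pairwise (fun p q => q.2 <= p.1) s ->
    (forall p, p \in s -> `]p.1, p.2[ `<=` U) ->
    \sum_(p <- s) `|g p.2 - g p.1| < e.
Proof.
move=> acg e e0; have [d d0 dP] := acg e e0; exists d => // s U mU Ud sab ps sU.
pose J (i : 'I_(size s)) := tnth (in_tuple s) i.
have Js i : J i \in s by rewrite /J mem_tnth.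
have J12 i : [&& a <= (J i).1, (J i).1 <= (J i).2 & (J i).2 <= b].
  by move/allP : sab => /(_ _ (Js i)).
have tJ : trivIset [set: 'I_(size s)] (fun i => `](J i).1, (J i).2[%classic).
  apply/trivIsetP => i j _ _ ij; rewrite -subset0 => x [].
  wlog lt_ij : i j ij / (i < j)%N.
    move=> wl; move: (ij); rewrite neq_ltn => /orP[|ji]; first exact: wl.
    by move=> xi xj; apply: (wl j i) => //; rewrite eq_sym.
  have := @pairwiseP _ (fun p q : R * R => q.2 <= p.1) (0, 0) s.
  move=> /elimT/(_ ps i j); rewrite !inE/= !ltn_ord => /(_ isT isT lt_ij).
  rewrite /J !(tnth_nth (0, 0))/= !in_itv/= => ji /andP[ix _] /andP[_ xj].
  by move: (lt_le_trans xj ji); rewrite ltNge (ltW ix).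
rewrite big_tnth; apply: (dP _ J) => //.
  by move=> i; have /and3P[] := J12 i.
rewrite -lte_fin -lebesgue_measure_bigsetU_itv//; last first.
  by move=> i; have /and3P[] := J12 i.
apply: le_lt_trans Ud; apply: le_measure; rewrite ?inE//.
  exact: bigsetU_measurable.
by elim/big_ind : _ => // [A B AU BU|i _]; [rewrite subUset | exact: sU].
Qed.

(** Cover the null set where nothing is known of the derivative by an open set U
    of small measure.  Walking from a to b, each point is crossed either by an
    interval on which h loses at most e1 times its length (nonnegative
    derivative), or by an interval contained in U.  The latter are disjoint and
    of small total length, so that h loses little on them by absolute
    continuity. *)
Lemma absolutely_continuous_derive_ge0 (R : realType) (a b : R) (h : R -> R) :
  a <= b -> absolutely_continuous a b h ->
  {ae mu, forall t : R, a < t < b -> exists2 l, 0 <= l & is_derive t 1 h l} ->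
  h a <= h b.
Proof.
move=> ab ach [N0 [mN0 N00 N0P]].
apply/ler_addgt0Pr => e e0.
pose e1 := e / (b - a + 1).
have ba1 : 0 < b - a + 1 by lra.
have e10 : 0 < e1 by exact: divr_gt0.
have [d d0 dP] := absolutely_continuous_seq ach e10.
(* The end points are exceptional too: the derivative is known only inside. *)
pose N := N0 `|` ([set a] `|` [set b]).
have mN : measurable N by apply: measurableU => //; exact: measurableU.
have N_0 : mu N = 0%E.
  have mab : mu ([set a] `|` [set b]) = 0%E.
    by rewrite measureU0//; exact: lebesgue_measure_set1.
  by rewrite measureU0//; exact: measurableU.
have Noo : (mu N < +oo)%E by rewrite N_0.
have [U [oU NU UNd]] := lebesgue_regularity_outer mN Noo d0.
have mU : measurable U by exact: measurable_realfun.open_measurable.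
have Ud : (mu U < d%:E)%E.
  have mUN : measurable (U `\` N) by exact: measurableD.
  have UNE : mu (U `\` N `|` N) = mu (U `\` N) by rewrite measureU0.
  apply: le_lt_trans UNd; rewrite -[leRHS]UNE.
  apply: le_measure; rewrite ?inE//; first exact: measurableU.
  by move=> x Ux; case: (pselect (N x)); [right|left].
(* The list s records the intervals contained in U that were crossed so far,
   the latest one first. *)
pose Q x := exists s : seq (R * R),
  [/\ all (fun p => [&& a <= p.1, p.1 <= p.2 & p.2 <= x]) s,
      pairwise (fun p q => q.2 <= p.1) s,
      (forall p, p \in s -> `]p.1, p.2[ `<=` U) &
      h a - h x <= e1 * (x - a) + \sum_(p <- s) `|h p.2 - h p.1|].
have [s [sab ps sU hs]] : Q b.
  apply: (@interval_induction _ a b) => //.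
    by exists [::]; rewrite big_nil !subrr mulr0 addr0.
  move=> x /andP[ax xb].
  have [Nx|Nx] := pselect (N x).
    have [r /= r0 rU] : nbhs x U by apply: open_nbhs_nbhs; split => //; exact: NU.
    exists r => // u v /andP[au ux] /andP[xv vb] ru vr [s [sau ps sU hs]].
    exists ((u, v) :: s); split.
    - rewrite /= au (le_trans ux xv) lexx/=; apply: sub_all sau => p.
      by move=> /and3P[-> -> /le_trans->]//; exact: le_trans xv.
    - rewrite /= ps andbT; apply: sub_all sau => p.
      by move=> /and3P[_ _].
    - move=> p; rewrite inE => /predU1P[->/= y|]; last exact: sU.
      rewrite /= in_itv/= => /andP[uy yv]; apply: rU.
      by rewrite /ball_/= ltr_norml; apply/andP; split; lra.
    - rewrite big_cons/=.
      have : h u - h v <= `|h v - h u| by rewrite -normrN opprB ler_norm.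
      have : e1 * (u - a) <= e1 * (v - a).
        by rewrite ler_pM2l// lerD2r (le_trans ux).
      lra.
  have [l l0 xl] : exists2 l, 0 <= l & is_derive x 1 h l.
    have : ~ (~` [set x | a < x < b -> exists2 l, 0 <= l & is_derive x 1 h l]) x.
      by move=> /N0P ?; apply: Nx; left.
    move=> /contrapT; apply.
    rewrite !lt_neqAle ax xb !andbT; apply/andP; split; apply/eqP => xE; apply: Nx.
      by right; left.
    by right; right.
  have [r r0 rP] := derive_ge0_increment l0 xl e10.
  exists r => // u v /andP[au ux] /andP[xv vb] ru vr [s [sau ps sU hs]].
  exists s; split => //.
  - apply: sub_all sau => p.
    by move=> /and3P[-> -> /le_trans->]//; exact: le_trans xv.
  - have -> : e1 * (v - a) = e1 * (v - u) + e1 * (u - a) by ring.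
    by have := rP _ _ ux xv ru vr; lra.
rewrite -lerBlDl; apply: (le_trans hs).
have -> : e = e1 * (b - a) + e1 by rewrite /e1; field; rewrite gt_eqF.
by rewrite lerD2l ltW// (dP s U).
Qed.

Lemma absolutely_continuousS (R : realType) (a b a' b' : R) (g : R -> R) :
  a <= a' -> b' <= b -> absolutely_continuous a b g ->
  absolutely_continuous a' b' g.
Proof.
move=> aa bb acg e e0; have [d d0 dP] := acg e e0; exists d => // n J J'.
apply: dP => i; have [aJ [JJ Jb]] := J' i.
by split; [exact: le_trans aJ | split => //; exact: le_trans bb].
Qed.

Lemma absolutely_continuousB (R : realType) (a b : R) (g k : R -> R) :
  absolutely_continuous a b g -> absolutely_continuous a b k ->
  absolutely_continuous a b (fun x => g x - k x).
Proof.
move=> acg ack e e0.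
have e2 : 0 < e / 2 by exact: divr_gt0.
have [d d0 dP] := acg _ e2; have [d' d0' dP'] := ack _ e2.
exists (Num.min d d'); first by rewrite lt_min d0.
move=> n J Jab tJ; rewrite lt_min => /andP[Jd Jd'].
have := dP n J Jab tJ Jd; have := dP' n J Jab tJ Jd'.
have : \sum_(i < n) `|g (J i).2 - k (J i).2 - (g (J i).1 - k (J i).1)| <=
  \sum_(i < n) `|g (J i).2 - g (J i).1| + \sum_(i < n) `|k (J i).2 - k (J i).1|.
  rewrite -big_split/=; apply: ler_sum => i _.
  rewrite (_ : _ - _ = g (J i).2 - g (J i).1 - (k (J i).2 - k (J i).1));
    last by ring.
  exact: ler_normB.
lra.
Qed.

Lemma absolutely_continuous_integral (R : realType) (a b : R) (r : R -> R) :
  mu.-integrable setT (EFin \o r) ->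
  absolutely_continuous a b (fun x => \int[mu]_(t in `]-oo, x]) r t).
Proof.
move=> ir e e0; have [d [d0 dP]] := integral_normr_continuous ir e0.
exists d => // n J Jab tJ Jd.
have ir' D : measurable D -> mu.-integrable D (EFin \o r).
  by move=> mD; apply: integrableS ir.
pose D := \big[setU/set0]_(i < n) `](J i).1, (J i).2[%classic.
have mD : measurable D by apply: bigsetU_measurable.
have inr : mu.-integrable D (EFin \o (fun t => `|r t|)).
  by apply: integrable_norm; exact: ir'.
apply: le_lt_trans (dP D mD _); last first.
  rewrite [ltLHS](lebesgue_measure_bigsetU_itv _ tJ) ?lte_fin// => i.
  by have [_ []] := Jab i.
rewrite -lee_fin fineK; last by apply: integrable_fin_num.
rewrite integral_bigsetU_EFin//= ?index_enum_uniq//; last 2 first.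
  by apply: sub_trivIset tJ.
  by case/integrableP: inr.
rewrite -sumEFin; apply: lee_sum => i _.
have [aJ [J12 Jb]] := Jab i.
rewrite Rintegral_itvB//; last exact: ir'.
rewrite -Rintegral_itv_bndo_bndc; last exact: ir'.
rewrite -[leRHS]fineK; last first.
  apply: integrable_fin_num => //.
  by apply: (@integrable_norm _ _ _ mu _ r); exact: ir'.
by rewrite lee_fin; apply: le_normr_Rintegral => //; exact: ir'.
Qed.

(** The indefinite integral F of r is absolutely continuous, with derivative r
    almost everywhere by Lebesgue's differentiation theorem.  Hence F - h and
    h - F are both nondecreasing. *)
Lemma absolutely_continuous_FTC (R : realType) (a b : R) (h r : R -> R) :
  a <= b -> absolutely_continuous a b h ->
  mu.-integrable `[a, b] (EFin \o r) ->
  {ae mu, forall t : R, a < t < b -> is_derive t 1 h (r t)} ->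
  \int[mu]_(t in `[a, b]) r t = h b - h a.
Proof.
move=> ab ach ir hr.
pose r0 := r \_ `[a, b].
have ir0 : mu.-integrable setT (EFin \o r0).
  by rewrite /r0 -restrict_EFin; apply/integrable_restrict => //; rewrite setTI.
pose F x := \int[mu]_(t in `]-oo, x]) r0 t.
have acF : absolutely_continuous a b F by exact: absolutely_continuous_integral.
have dF : {ae mu, forall t : R, is_derive t 1 F (r0 t)}.
  have lr0 : locally_integrable setT r0 by exact: integrable_locally.
  have ir0y y : mu.-integrable `]-oo, y] (EFin \o r0) by exact: integrableS ir0.
  have := FTC1Ny ir0y lr0; apply: filterS => t [Ft Ftr].
  by apply: (DeriveDef Ft); rewrite -derive1E.
have FE : F b - F a = \int[mu]_(t in `[a, b]) r t.
  rewrite /F Rintegral_itvB//; last exact: integrableS ir0.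
  rewrite Rintegral_itv_obnd_cbnd; last exact: integrableS ir0.
  by apply: eq_Rintegral => t tab; rewrite /r0 patchE tab.
have dFh : {ae mu, forall t : R, a < t < b ->
    is_derive t 1 F (r t) /\ is_derive t 1 h (r t)}.
  apply: filterS2 dF hr => t Ft ht tab; split; last exact: ht.
  have -> // : r t = r0 t.
  by rewrite /r0 patchE mem_set//= in_itv/=; case/andP: tab => /ltW-> /ltW->.
have : F a - h a <= F b - h b.
  apply: (absolutely_continuous_derive_ge0 ab (absolutely_continuousB acF ach)).
  apply: filterS dFh => t /[apply] -[Ft ht]; exists 0 => //.
  by rewrite -(subrr (r t)); apply: is_deriveB.
have : h a - F a <= h b - F b.
  apply: (absolutely_continuous_derive_ge0 ab (absolutely_continuousB ach acF)).
  apply: filterS dFh => t /[apply] -[Ft ht]; exists 0 => //.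
  by rewrite -(subrr (r t)); apply: is_deriveB.
by rewrite -FE; lra.
Qed.

(** * Fubini's theorem for real-valued integrals *)

(** Tonelli's measurability statement applied to the positive and negative parts,
    whose integrals may be infinite. *)
Lemma measurable_integral_section (d1 d2 : measure_display)
    (T1 : measurableType d1) (T2 : measurableType d2) (R : realType)
    (m2 : {sigma_finite_measure set T2 -> \bar R}) (f : T1 * T2 -> \bar R) :
  measurable_fun [set: T1 * T2] f ->
  measurable_fun [set: T1] (fun x => \int[m2]_y f (x, y))%E.
Proof.
move=> mf; rewrite [X in measurable_fun _ X](_ : _ = fun x =>
    (\int[m2]_y (f^\+ (x, y)) - \int[m2]_y (f^\- (x, y)))%E).
  apply: emeasurable_funB.
    apply: (measurable_fun_fubini_tonelli_F (f^\+)%E) => //.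
    exact: measurable_funepos.
  apply: (measurable_fun_fubini_tonelli_F (f^\-)%E) => //.
  exact: measurable_funeneg.
apply/funext => x; rewrite [LHS]integralE; congr (_ - _)%E.
  by apply: eq_integral => y _; rewrite !funeposE.
by apply: eq_integral => y _; rewrite !funenegE.
Qed.

(** The inner real-valued integrals agree with the extended ones only at the
    almost every point where the section is integrable. *)
Lemma Rintegral_Fubini (d1 d2 : measure_display)
    (T1 : measurableType d1) (T2 : measurableType d2) (R : realType)
    (m1 : {sigma_finite_measure set T1 -> \bar R})
    (m2 : {sigma_finite_measure set T2 -> \bar R}) (W : T1 * T2 -> R) :
  (m1 \x m2)%E.-integrable setT (EFin \o W) ->
  [/\ m1.-integrable setT (EFin \o (fun x => \int[m2]_y W (x, y))),
      m2.-integrable setT (EFin \o (fun y => \int[m1]_x W (x, y))) &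
      \int[m1]_x \int[m2]_y W (x, y) = \int[m2]_y \int[m1]_x W (x, y)].
Proof.
have fine_le (x : \bar R) : (`|(fine x)%:E| <= `|x|)%E.
  by case: x => [x| |] //=; rewrite ?normr0 ?leey.
move=> iW; have mF := measurable_fubini_F iW; have mG := measurable_fubini_G iW.
have iF := integrable_fubini_F iW.
have mW := measurable_int _ iW.
have iG : m2.-integrable setT (fubini_G m1 (EFin \o W)).
  apply/integrableP; split => //.
  apply: le_lt_trans ((integrable21ltyP m1 m2 mW).1 iW).
  apply: ge0_le_integral => //.
  - exact: measurableT_comp.
  - apply: (measurable_fun_fubini_tonelli_G (abse \o (EFin \o W))) => [|p].
      exact: measurableT_comp.
    exact: abse_ge0.
  - move=> y _; apply: le_abse_integral => //.
    exact: measurableT_comp (pair2_measurable y).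
have mfF : measurable_fun setT (EFin \o (fun x => \int[m2]_y W (x, y))).
  by apply/measurable_EFinP; apply: measurableT_comp mF.
have mfG : measurable_fun setT (EFin \o (fun y => \int[m1]_x W (x, y))).
  by apply/measurable_EFinP; apply: measurableT_comp mG.
have FE : ae_eq m1 setT (fubini_F m2 (EFin \o W))
                        (EFin \o (fun x => \int[m2]_y W (x, y))).
  apply: filterS (ae_integrable1 iW) => x ix _.
  by rewrite /= fineK//; apply: integrable_fin_num.
have GE : ae_eq m2 setT (fubini_G m1 (EFin \o W))
                        (EFin \o (fun y => \int[m1]_x W (x, y))).
  apply: filterS (ae_integrable2 iW) => x ix _.
  by rewrite /= fineK//; apply: integrable_fin_num.
split.
- by apply: le_integrable iF => // x _; exact: fine_le.
- by apply: le_integrable iG => // x _; exact: fine_le.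
- congr fine; transitivity (\int[m1]_x fubini_F m2 (EFin \o W) x)%E.
    by apply/esym/ae_eq_integral => //.
  transitivity (\int[m2]_y fubini_G m1 (EFin \o W) y)%E.
    by rewrite /fubini_F /fubini_G; exact: Fubini.
  by apply/ae_eq_integral => //.
Qed.

Lemma integrable_tensor (d1 d2 : measure_display)
    (T1 : measurableType d1) (T2 : measurableType d2) (R : realType)
    (m1 : {sigma_finite_measure set T1 -> \bar R})
    (m2 : {sigma_finite_measure set T2 -> \bar R}) (u : T1 -> R) (v : T2 -> R) :
  m1.-integrable setT (EFin \o u) -> m2.-integrable setT (EFin \o v) ->
  (m1 \x m2)%E.-integrable setT (EFin \o (fun p => u p.1 * v p.2)).
Proof.
move=> /integrableP[mu' iu] /integrableP[mv iv].
have mK : measurable_fun setT (fun p : T1 * T2 => u p.1 * v p.2).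
  apply: measurable_funM.
    by apply: (measurableT_comp _ measurable_fst); exact/measurable_EFinP.
  by apply: (measurableT_comp _ measurable_snd); exact/measurable_EFinP.
have mabs d (T : measurableType d) (g : T -> R) :
    measurable_fun setT (EFin \o g) -> measurable_fun setT (fun x => `|g x|%:E).
  by move=> /measurable_EFinP mg; apply/measurable_EFinP; exact: measurableT_comp.
apply/integrable12ltyP => /=; first exact/measurable_EFinP.
under eq_integral => x _.
  under eq_integral do rewrite normrM EFinM.
  rewrite ge0_integralZl//; last exact: mabs.
  over.
rewrite ge0_integralZr//; [|exact: mabs|exact: integral_ge0].
have u0 : (0 <= \int[m1]_x `|(u x)%:E|)%E by exact: integral_ge0.
by apply: lte_mul_pinfty; rewrite ?ge0_fin_numE.
Qed.

(** * Cancellation of the exchanges below a level *)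

Lemma integrable_sub_itv (R : realType) (a b c d : R) (g : R -> R) :
  a <= c -> d <= b -> mu.-integrable `[a, b] (EFin \o g) ->
  mu.-integrable `[c, d] (EFin \o g).
Proof.
move=> ac db; apply: integrableS => //.
by apply: subset_itv; rewrite bnd_simp.
Qed.

Lemma integrable_patch (R : realType) (a b : R) (g : R -> R) :
  mu.-integrable `[a, b] (EFin \o g) <->
  mu.-integrable setT (EFin \o (g \_ `[a, b])).
Proof. by rewrite -restrict_EFin; exact: integrable_mkcond. Qed.

(** Fubini's theorem on the triangle a <= y <= x <= b, for the kernel
    K(x,y) = u(x) v(y). *)
Lemma integral_triangle_swap (R : realType) (a b : R) (u v : R -> R) :
  mu.-integrable `[a, b] (EFin \o u) -> mu.-integrable `[a, b] (EFin \o v) ->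
  [/\ mu.-integrable `[a, b] (EFin \o (fun x => u x * \int[mu]_(y in `[a, x]) v y)),
      mu.-integrable `[a, b] (EFin \o (fun y => v y * \int[mu]_(x in `[y, b]) u x)) &
  \int[mu]_(x in `[a, b]) (u x * \int[mu]_(y in `[a, x]) v y) =
  \int[mu]_(y in `[a, b]) (v y * \int[mu]_(x in `[y, b]) u x)].
Proof.
move=> iu iv.
have iuT := (integrable_patch _ _ _).1 iu.
have ivT := (integrable_patch _ _ _).1 iv.
pose K (p : measurableTypeR R * measurableTypeR R) :=
  if p.2 <= p.1 then (u \_ `[a, b]) p.1 * (v \_ `[a, b]) p.2 else 0.
have Kx : (fun x => \int[mu]_y K (x, y)) =
    (fun x => u x * \int[mu]_(y in `[a, x]) v y) \_ `[a, b].
  apply/funext => x.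
  rewrite /K /= !patchE; case: ifPn => [|_]; last first.
    under eq_Rintegral do rewrite mul0r if_same.
    by rewrite Rintegral_cst// mul0r.
  rewrite inE/= in_itv/= => /andP[ax xb].
  rewrite -RintegralZl//; last first.
    exact: integrable_sub_itv iv.
  rewrite [RHS]Rintegral_mkcond; apply: eq_Rintegral => y _.
  rewrite !patchE !mem_setE !in_itv/=.
  have [ay|] := leP a y; rewrite ?mulr0 ?if_same//=.
  have [yx|//] := leP y x.
  by rewrite (le_trans yx xb).
have Ky : (fun y => \int[mu]_x K (x, y)) =
    (fun y => v y * \int[mu]_(x in `[y, b]) u x) \_ `[a, b].
  apply/funext => y.
  rewrite /K /= !patchE; case: ifPn => [|_]; last first.
    under eq_Rintegral do rewrite mulr0 if_same.
    by rewrite Rintegral_cst// mul0r.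
  rewrite inE/= in_itv/= => /andP[ay yb].
  rewrite -RintegralZl//; last first.
    exact: integrable_sub_itv iu.
  rewrite [RHS]Rintegral_mkcond; apply: eq_Rintegral => x _.
  rewrite !patchE !mem_setE !in_itv/=.
  have [yx|//] := leP y x.
  by rewrite (le_trans ay yx)/=; case: ifP => _; rewrite ?mul0r// mulrC.
have iK : (@lebesgue_measure R \x @lebesgue_measure R)%E.-integrable setT
    (EFin \o K).
  have iuv := integrable_tensor iuT ivT; have muv := measurable_int _ iuv.
  apply: le_integrable iuv => //.
    apply/measurable_EFinP/measurable_fun_ifT => //.
      by apply: measurable_fun_ler.
    exact/measurable_EFinP.
  by move=> [x y] _ /=; rewrite lee_fin /K/=; case: ifP; rewrite ?normr0.
have [iKx iKy KE] := Rintegral_Fubini iK.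
split; [by apply/integrable_patch; rewrite -Kx
       |by apply/integrable_patch; rewrite -Ky|].
by rewrite Rintegral_mkcond [RHS]Rintegral_mkcond -Kx -Ky.
Qed.

(** This is the right-hand side of the equation integrated below the level c, at
    a fixed time, with u = f and v = alpha f.  Splitting the integral of u over
    [x,b] at c, the part over [x,c] cancels against the gain term by
    integral_triangle_swap; what remains is the loss to the points above c. *)
Lemma integral_pairwise_exchange (R : realType) (a b c : R) (u v : R -> R) :
  a <= c <= b ->
  mu.-integrable `[a, b] (EFin \o u) -> mu.-integrable `[a, b] (EFin \o v) ->
  \int[mu]_(x in `[a, c]) (- (v x * \int[mu]_(y in `[x, b]) u y)
                           + u x * \int[mu]_(y in `[a, x]) v y) =
  - ((\int[mu]_(x in `[a, c]) v x) * \int[mu]_(x in `[c, b]) u x).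
Proof.
move=> /andP[ac cb] iu iv.
have iac g : mu.-integrable `[a, b] (EFin \o g) ->
    mu.-integrable `[a, c] (EFin \o g).
  exact: integrable_sub_itv.
have [iuv ivu swap] := integral_triangle_swap (iac _ iu) (iac _ iv).
have ivc := iac _ iv.
set B := \int[mu]_(x in `[c, b]) u x.
have splitB x : x \in `[a, c] -> \int[mu]_(y in `[x, b]) u y =
    \int[mu]_(y in `[x, c]) u y + B.
  rewrite in_itv/= => /andP[ax xc].
  have ixb : mu.-integrable `[x, b] (EFin \o u).
    exact: integrable_sub_itv iu.
  have icb : mu.-integrable `]c, b] (EFin \o u).
    apply: integrableS iu => //; apply: subset_itvr; rewrite bnd_simp//.
  have := @Rintegral_itvB R u (BLeft x) (BRight b) c ixb.
  rewrite !bnd_simp => /(_ xc cb); rewrite Rintegral_itv_obnd_cbnd// -/B.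
  by move=> <-; rewrite addrC subrK.
have ivB : mu.-integrable `[a, c] (EFin \o (fun x => v x * B)).
  exact: (integrableZr _ B ivc).
transitivity (\int[mu]_(x in `[a, c])
    ((u x * \int[mu]_(y in `[a, x]) v y - v x * \int[mu]_(y in `[x, c]) u y)
     - v x * B)).
  apply: eq_Rintegral => x /set_mem xac.
  by rewrite (splitB _ xac); ring.
rewrite RintegralB//; last exact: (integrableB _ iuv ivu).
by rewrite RintegralB// swap subrr sub0r RintegralZr.
Qed.

(** * Measurability and integrability of the right-hand side *)

(** E describes a domain of integration that moves with the first variable; both
    nonlocal terms of the equation have this form. *)
Lemma measurable_sliced_integral (R : realType) (w : R * R -> R)
    (E : set (R * R)) :
  measurable_fun setT w -> measurable E ->
  measurable_fun setT
    (fun p : R * R => \int[mu]_(y in [set y | E (p.1, y)]) w (y, p.2)).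
Proof.
move=> mw mE.
pose E' := [set q : (R * R) * R | E (q.1.1, q.2)].
pose w' := (fun q : (R * R) * R => w (q.2, q.1.2)) \_ E'.
have m11 : measurable_fun setT (fun q : (R * R) * R => q.1.1).
  exact: (measurableT_comp measurable_fst measurable_fst).
have m12 : measurable_fun setT (fun q : (R * R) * R => q.1.2).
  exact: (measurableT_comp measurable_snd measurable_fst).
have m2 : measurable_fun setT (fun q : (R * R) * R => q.2).
  exact: measurable_snd.
have mE' : measurable E'.
  rewrite -[E']setTI.
  have m := measurable_fun_pair m11 m2.
  exact: (m measurableT _ mE).
have mw' : measurable_fun setT w'.
  have m := measurable_fun_pair m2 m12.
  have [+ _] := measurable_restrictT (fun q : (R * R) * R => w (q.2, q.1.2)) mE'.
  apply; apply: measurable_funS (measurableT_comp mw m) => //.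
have mew' : measurable_fun setT (EFin \o w') by exact/measurable_EFinP.
have mI := measurable_integral_section (@lebesgue_measure R) mew'.
have mfI : measurable_fun setT (fun p : R * R => \int[mu]_y w' (p, y)).
  by apply: measurableT_comp mI.
apply: eq_measurable_fun mfI => p _ /=; rewrite [RHS]Rintegral_mkcond.
by apply: eq_Rintegral => y _; rewrite !patchE.
Qed.

Lemma measurable_section (d1 d2 d3 : measure_display)
    (T1 : measurableType d1) (T2 : measurableType d2) (T3 : measurableType d3)
    (A : set T1) (B : set T2) (g : T1 -> T2 -> T3) (t : T2) :
  measurable A -> measurable B ->
  measurable_fun (A `*` B) (fun p => g p.1 p.2) -> B t ->
  measurable_fun A (g^~ t).
Proof.
move=> mA mB mg Bt.
apply: (measurable_comp (F := A `*` B) (g := fun x => (x, t)) _ _ mg) => //.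
- exact: measurableX.
- by move=> _ [x Ax <-].
- exact: measurable_funTS.
Qed.

Lemma measurable_slice (R : realType) (zbar : R) (g : R -> R -> R) (t : R) :
  measurable_fun (`[0, zbar]%classic `*` `[0, +oo[%classic : set (R * R))
    (fun p : R * R => g p.1 p.2) ->
  0 <= t -> measurable_fun `[0, zbar] (g^~ t).
Proof.
move=> mg t0; apply: (measurable_section _ _ mg) => //.
by rewrite /= in_itv/= t0.
Qed.

Lemma normr_Rintegral_le (d : measure_display) (T : measurableType d)
    (R : realType) (m : {measure set T -> \bar R}) (D E : set T) (g h : T -> R) :
  measurable D -> measurable E -> D `<=` E ->
  measurable_fun E g -> m.-integrable E (EFin \o h) ->
  (forall x, E x -> `|g x| <= `|h x|) ->
  `|\int[m]_(x in D) g x| <= \int[m]_(x in E) `|h x|.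
Proof.
move=> mD mE DE mg ih gh.
have ig : m.-integrable E (EFin \o g).
  by apply: le_integrable ih => //; exact/measurable_EFinP.
apply: le_trans (le_normr_Rintegral mD (integrableS mE mD DE ig)) _.
have -> : D = E `&` D by apply/esym/setIidr.
rewrite Rintegral_mkcondr; apply: le_Rintegral => //.
- rewrite -restrict_EFin; apply/integrable_restrict => //.
  by apply: integrableS (integrable_norm ig) => //; exact: measurableI.
- exact: integrable_norm.
- move=> x Ex; rewrite patchE; case: ifP => _; last exact: normr_ge0.
  exact: gh.
Qed.

Lemma measurable_rhs (R : realType) (zbar : R) (alpha f : R -> R -> R) :
  measurable_fun (`[0, zbar]%classic `*` `[0, +oo[%classic : set (R * R))
    (fun p : R * R => alpha p.1 p.2) ->
  measurable_fun (`[0, zbar]%classic `*` `[0, +oo[%classic : set (R * R))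
    (fun p : R * R => f p.1 p.2) ->
  measurable_fun (`[0, zbar]%classic `*` `[0, +oo[%classic : set (R * R))
    (fun p : R * R => rhs zbar alpha f p.1 p.2).
Proof.
set D := (X in measurable_fun X) => ma mf.
have mD : measurable D by apply: measurableX.
have maf : measurable_fun D (fun p => alpha p.1 p.2 * f p.1 p.2).
  exact: measurable_funM.
have mfst : measurable_fun setT (fun p : R * R => p.1) by exact: measurable_fst.
have msnd : measurable_fun setT (fun p : R * R => p.2) by exact: measurable_snd.
have mleP (g h : R * R -> R) : measurable_fun setT g -> measurable_fun setT h ->
    measurable [set p | g p <= h p].
  move=> mg mh.
  have := measurable_fun_ler mg mh measurableT (_ : measurable [set true]).
  by rewrite setTI => /(_ I).
pose Er := [set p : R * R | p.2 \in `[p.1, zbar]].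
pose El := [set p : R * R | p.2 \in `[0, p.1]].
have mEr : measurable Er.
  rewrite [Er](_ : _ = [set p | p.1 <= p.2] `&` [set p | p.2 <= zbar]).
    by apply: measurableI; exact: mleP.
  by apply/seteqP; split => p; rewrite /Er/= in_itv/= => /andP.
have mEl : measurable El.
  rewrite [El](_ : _ = [set p | 0 <= p.2] `&` [set p | p.2 <= p.1]).
    by apply: measurableI; exact: mleP.
  by apply/seteqP; split => p; rewrite /El/= in_itv/= => /andP.
have [mfD _] := measurable_restrictT (fun p => f p.1 p.2) mD.
have [mafD _] := measurable_restrictT (fun p => alpha p.1 p.2 * f p.1 p.2) mD.
have mP := measurable_sliced_integral (mfD mf) mEr.
have mQ := measurable_sliced_integral (mafD maf) mEl.
apply: measurable_funD.
  apply: measurable_funM.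
    by apply: measurable_funM => //; exact: measurable_funN.
  apply: (@eq_measurable_fun _ _ _ _ _ _ _ _ (measurable_funTS mP)).
  move=> [z t]; rewrite inE /D/= !in_itv/= => -[/andP[z0 zz] /andP[t0 _]].
  apply: eq_Rintegral => y; rewrite inE /Er/= in_itv/= => /andP[zy yz].
  by rewrite patchE mem_set// /D/= !in_itv/= t0 (le_trans z0 zy) yz.
apply: measurable_funM => //.
apply: (@eq_measurable_fun _ _ _ _ _ _ _ _ (measurable_funTS mQ)).
move=> [z t]; rewrite inE /D/= !in_itv/= => -[/andP[z0 zz] /andP[t0 _]].
apply: eq_Rintegral => y; rewrite inE /El/= in_itv/= => /andP[y0 yz].
by rewrite patchE mem_set// /D/= !in_itv/= t0 y0 (le_trans yz zz).
Qed.

(** Both nonlocal factors are bounded by the L1 norm of f(.,t), as alpha is at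
    most 1. *)
Lemma normr_rhs_le (R : realType) (zbar : R) (alpha f : R -> R -> R) (z t : R) :
  measurable_fun `[0, zbar] (alpha^~ t) ->
  (forall y, y \in `[0, zbar] -> 0 <= alpha y t <= 1) ->
  mu.-integrable `[0, zbar] (fun z => (f z t)%:E) ->
  z \in `[0, zbar] ->
  `|rhs zbar alpha f z t| <=
  (\int[mu]_(y in `[0, zbar]) `|f y t|) *+ 2 * `|f z t|.
Proof.
move=> ma a01 intf zz.
have mf : measurable_fun `[0, zbar] (f^~ t).
  by apply/measurable_EFinP; exact: measurable_int intf.
have [z0 zb] : 0 <= z /\ z <= zbar by apply/andP; move: zz; rewrite in_itv.
have B1 : `|\int[mu]_(y in `[z, zbar]) f y t| <=
    \int[mu]_(y in `[0, zbar]) `|f y t|.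
  apply: (@normr_Rintegral_le _ _ _ mu _ _ (f^~ t) (f^~ t)) => //.
  by apply: subset_itvr; rewrite bnd_simp.
have B2 : `|\int[mu]_(y in `[0, z]) (alpha y t * f y t)| <=
    \int[mu]_(y in `[0, zbar]) `|f y t|.
  apply: (@normr_Rintegral_le _ _ _ mu _ _ _ (f^~ t)) => //.
  - by apply: subset_itvl; rewrite bnd_simp.
  - exact: measurable_funM.
  - move=> y yz; have /andP[a0 a1] := a01 y yz.
    by rewrite normrM ler_piMl// ger0_norm.
have /andP[a0 a1] := a01 z zz.
rewrite /rhs; apply: (le_trans (ler_normD _ _)).
rewrite !normrM normrN (ger0_norm a0) mulr2n mulrDl; apply: lerD.
  rewrite mulrC; apply: ler_pM => //; first by rewrite mulr_ge0.
  by rewrite ler_piMl.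
by rewrite mulrC; apply: ler_wpM2r.
Qed.

(** The L1 norm of f(.,t) is bounded on the time interval, say by C; then by
    normr_rhs_le the right-hand side at a given time has L1 norm at most
    2 C^2. *)
Lemma integrable_rhs (R : realType) (zbar : R) (alpha f : R -> R -> R)
    (f0 : R -> R) (c s t : R) :
  learning_function zbar alpha -> is_solution zbar alpha f f0 ->
  c <= zbar -> 0 <= s ->
  (@lebesgue_measure R \x @lebesgue_measure R)%E.-integrable setT
    (EFin \o ((fun p => rhs zbar alpha f p.1 p.2) \_ (`[0, c] `*` `[s, t]))).
Proof.
move=> la sol czbar s0; set W := _ \_ _.
have mD : measurable (`[0, zbar]%classic `*` `[0, +oo[%classic : set (R * R)).
  exact: measurableX.
have mW : measurable_fun setT W.
  apply/(measurable_restrictT _ _).1; first exact: measurableX.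
  have mrhs := measurable_rhs (lf_measurable la) (sol_measurable sol).
  apply: measurable_funS mrhs => //.
  move=> [z y]/=; rewrite !in_itv/= => -[/andP[-> zc] /andP[sy _]].
  by rewrite (le_trans zc czbar) (le_trans s0 sy).
have mWE : measurable_fun setT (EFin \o W) by exact/measurable_EFinP.
have [C CP] := sol_bounded sol t.
apply/integrable21ltyP => //.
apply: (@le_lt_trans _ _ (\int[mu]_(y in `[s, t]) (C *+ 2 * C)%:E)%E); last first.
  rewrite integral_cst//= lebesgue_measure_itv/=.
  by case: ifP => _; rewrite ?mule0// -EFinB -EFinM ltry.
rewrite [leRHS]integral_mkcond.
apply: ge0_le_integral => //.
- by move=> y _; exact: integral_ge0.
- have := @measurable_fun_fubini_tonelli_G _ _ (measurableTypeR R)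
    (measurableTypeR R) R mu (abse \o (EFin \o W)).
  apply => [|p]; last exact: abse_ge0.
  exact: (measurableT_comp _ mWE).
- by apply/(measurable_restrictT _ _).1.
move=> y _; rewrite patchE; case: ifPn => [|yst]; last first.
  rewrite integral0_eq// => z _; rewrite /= /W patchE ifN ?normr0//.
  by apply: contra yst; rewrite !inE => -[].
rewrite inE/= in_itv/= => /andP[sy yt].
have y0 : 0 <= y by exact: le_trans sy.
have fy := sol_integrable sol y0.
set M := \int[mu]_(z in `[0, zbar]) `|f z y|.
have M0 : 0 <= M by apply: Rintegral_ge0.
have MC : M <= C by exact: CP.
have iM : mu.-integrable `[0, zbar] (EFin \o (fun z => M *+ 2 * `|f z y|)).
  exact: (integrableZl _ (M *+ 2) (integrable_norm fy)).
apply: (@le_trans _ _ (\int[mu]_(z in `[0%R, zbar]) (M *+ 2 * `|f z y|)%:E)%E).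
  rewrite [leRHS]integral_mkcond; apply: ge0_le_integral => //.
  - apply/measurable_EFinP; apply: measurableT_comp => //.
    exact: measurableT_comp mW (pair2_measurable y).
  - by apply/(measurable_restrictT _ _).1 => //; exact: measurable_int iM.
  - move=> z _; rewrite patchE /= /W patchE; case: ifPn => [|_]; last first.
      by rewrite normr0; case: ifP => // _; rewrite lee_fin mulr_ge0// mulrn_wge0.
    rewrite inE/= !in_itv/= => -[/andP[z0 zc] _].
    have zz : z \in `[0, zbar] by rewrite in_itv/= z0 (le_trans zc).
    rewrite mem_set//= lee_fin; apply: normr_rhs_le => //.
      exact: measurable_slice (lf_measurable la) y0.
    by move=> x xz; apply/andP; exact: (lf_range la).
rewrite -[leLHS]fineK; last exact: integrable_fin_num.
rewrite lee_fin [leLHS](RintegralZl _ _ (integrable_norm fy))// -/M.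
by rewrite ler_pM// ?mulrn_wge0// lerMn2r MC orbT.
Qed.

(** * Mass balance below a level *)

Lemma integrable_learning (R : realType) (zbar : R) (alpha f : R -> R -> R)
    (t : R) :
  learning_function zbar alpha -> 0 <= t ->
  mu.-integrable `[0, zbar] (EFin \o (f^~ t)) ->
  mu.-integrable `[0, zbar] (EFin \o (fun x => alpha x t * f x t)).
Proof.
move=> la t0 ft; have mft := measurable_int _ ft.
have mat := measurable_slice (lf_measurable la) t0.
apply: le_integrable ft => //.
  by apply/measurable_EFinP/measurable_funM => //; exact/measurable_EFinP.
move=> x xz /=; rewrite lee_fin normrM ler_piMl//.
by have [a0 a1] := lf_range la xz t0; rewrite ger0_norm.
Qed.

Lemma patch_setX (T1 T2 : Type) (R : realType) (A : set T1) (B : set T2)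
    (g : T1 * T2 -> R) (x : T1) (y : T2) :
  (g \_ (A `*` B)) (x, y) =
  if (x \in A) && (y \in B) then g (x, y) else 0.
Proof. by rewrite patchE in_setX. Qed.

Lemma Rintegral_patchX1 (d2 : measure_display) (T1 : Type)
    (T2 : measurableType d2) (R : realType) (m2 : {measure set T2 -> \bar R})
    (A : set T1) (B : set T2) (g : T1 * T2 -> R) :
  (fun x => \int[m2]_y (g \_ (A `*` B)) (x, y)) =
  (fun x => \int[m2]_(y in B) g (x, y)) \_ A.
Proof.
apply/funext => x; rewrite patchE; case: ifPn => xA.
  rewrite [RHS]Rintegral_mkcond; apply: eq_Rintegral => y _.
  by rewrite patch_setX xA patchE.
under eq_Rintegral do rewrite patch_setX (negbTE xA).
by rewrite Rintegral_cst// mul0r.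
Qed.

Lemma Rintegral_patchX2 (d1 : measure_display) (T1 : measurableType d1)
    (T2 : Type) (R : realType) (m1 : {measure set T1 -> \bar R})
    (A : set T1) (B : set T2) (g : T1 * T2 -> R) :
  (fun y => \int[m1]_x (g \_ (A `*` B)) (x, y)) =
  (fun y => \int[m1]_(x in A) g (x, y)) \_ B.
Proof.
apply/funext => y; rewrite patchE; case: ifPn => yB.
  rewrite [RHS]Rintegral_mkcond; apply: eq_Rintegral => x _.
  by rewrite patch_setX yB andbT patchE.
under eq_Rintegral do rewrite patch_setX (negbTE yB) andbF.
by rewrite Rintegral_cst// mul0r.
Qed.

Lemma eq_patch (T : Type) (R : realType) (A : set T) (g h : T -> R) :
  {in A, g =1 h} -> g \_ A = h \_ A.
Proof. by move=> gh; apply/funext => x; rewrite !patchE; case: ifP => // /gh. Qed.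

Lemma rhs_space_integral (R : realType) (zbar : R) (alpha f : R -> R -> R)
    (c t : R) :
  learning_function zbar alpha -> 0 <= c <= zbar -> 0 <= t ->
  mu.-integrable `[0, zbar] (EFin \o (f^~ t)) ->
  \int[mu]_(x in `[0, c]) rhs zbar alpha f x t =
  - ((\int[mu]_(x in `[0, c]) (alpha x t * f x t)) *
     \int[mu]_(x in `[c, zbar]) f x t).
Proof.
move=> la c0z t0 ft.
rewrite -(integral_pairwise_exchange c0z ft (integrable_learning la t0 ft)).
by apply: eq_Rintegral => x _; rewrite /rhs !mulNr.
Qed.

(** Integrability in time is left as a premise, to be supplied for almost every x
    by Fubini's theorem. *)
Lemma rhs_time_integral (R : realType) (zbar : R) (alpha f : R -> R -> R)
    (f0 : R -> R) (s t : R) :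
  is_solution zbar alpha f f0 -> 0 <= s <= t ->
  {ae mu, forall x : R, x \in `[0, zbar] ->
    mu.-integrable `[s, t] (EFin \o (rhs zbar alpha f x)) ->
    \int[mu]_(y in `[s, t]) rhs zbar alpha f x y = f x t - f x s}.
Proof.
move=> sol /andP[s0 st].
have ac := sol_abscont sol; have eqn := sol_eq sol.
apply: filterS2 ac eqn => x acx eqx xz ix.
apply: absolutely_continuous_FTC => //.
(* The horizon t + 1 is positive even when t = 0. *)
- apply: absolutely_continuousS (acx xz (t + 1) _) => //; first by rewrite lerDl.
  by rewrite ltr_wpDl// (le_trans s0).
- have := eqx xz; apply: filterS => y dy /andP[sy _]; apply: dy.
  exact: le_lt_trans sy.
Qed.

(** Integrate the right-hand side over [0,c] x [s,t] in both orders.  Time first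
    gives the increments of f by rhs_time_integral; space first gives the
    outgoing flux by rhs_space_integral.  The integrability of the flux, which
    comes with Fubini's theorem, is recorded for later comparisons. *)
Lemma mass_balance (R : realType) (zbar : R) (alpha f : R -> R -> R)
    (f0 : R -> R) (c s t : R) :
  learning_function zbar alpha -> is_solution zbar alpha f f0 ->
  0 <= c <= zbar -> 0 <= s <= t ->
  let AB y := (\int[mu]_(x in `[0, c]) (alpha x y * f x y)) *
              \int[mu]_(x in `[c, zbar]) f x y in
  mu.-integrable `[s, t] (EFin \o AB) /\
  \int[mu]_(x in `[0, c]) f x t =
  \int[mu]_(x in `[0, c]) f x s - \int[mu]_(y in `[s, t]) AB y.
Proof.
move=> la sol c0z sst AB.
have [c0 czbar] := andP c0z; have [s0 st] := andP sst.
have t0 : 0 <= t by exact: le_trans st.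
have ifc y : 0 <= y -> mu.-integrable `[0, c] (EFin \o (f^~ y)).
  by move=> y0; exact: integrable_sub_itv (sol_integrable sol y0).
have idf : mu.-integrable `[0, c] (EFin \o (fun x => f x t - f x s)).
  exact: (integrableB _ (ifc _ t0) (ifc _ s0)).
have idp : mu.-integrable setT
    (EFin \o ((fun x => f x t - f x s) \_ `[0, c])).
  exact: (integrable_patch _ _ _).1.
have mF := measurable_int _ idp.
have AEF : {ae mu, forall x : R, x \in `[0, zbar] ->
    mu.-integrable `[s, t] (EFin \o (rhs zbar alpha f x)) ->
    \int[mu]_(y in `[s, t]) rhs zbar alpha f x y = f x t - f x s}.
  exact: rhs_time_integral sol sst.
pose W := (fun p => rhs zbar alpha f p.1 p.2) \_ (`[0, c] `*` `[s, t]).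
have GE : (fun y => \int[mu]_x W (x, y)) = (fun y => - AB y) \_ `[s, t].
  rewrite /W Rintegral_patchX2; apply: eq_patch => y; rewrite inE/= in_itv/=.
  move=> /andP[sy _]; have y0 := le_trans s0 sy.
  exact: rhs_space_integral la c0z y0 (sol_integrable sol y0).
have FE : (fun x => \int[mu]_y W (x, y)) =
    (fun x => \int[mu]_(y in `[s, t]) rhs zbar alpha f x y) \_ `[0, c].
  by rewrite /W Rintegral_patchX1.
have iW := integrable_rhs t la sol czbar s0 (c := c).
have iWx := ae_integrable1 iW.
have [iF iG FG] := Rintegral_Fubini iW.
have iAB : mu.-integrable `[s, t] (EFin \o AB).
  have iN : mu.-integrable `[s, t] (EFin \o (fun y => - AB y)).
    by move: iG; rewrite GE => /(integrable_patch _ _ _).2.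
  have := integrableN iN; apply: eq_integrable => [|y _ /=].
    exact: measurable_itv.
  by rewrite opprK.
split; first exact: iAB.
have EF : \int[mu]_x \int[mu]_y W (x, y) =
    \int[mu]_(x in `[0, c]) f x t - \int[mu]_(x in `[0, c]) f x s.
  rewrite -RintegralB; [|exact: measurable_itv|exact: ifc|exact: ifc].
  rewrite [RHS]Rintegral_mkcond; congr fine; apply: ae_eq_integral.
  - exact: measurableT.
  - exact: measurable_int iF.
  - exact: mF.
  apply: filterS2 iWx AEF => x ix xE _; congr EFin.
  rewrite (congr1 (fun h => h x) FE) !patchE; case: ifPn => xc; last by reflexivity.
  move: xc; rewrite inE/= in_itv/= => /andP[x0 xc].
  apply: xE; first by rewrite in_itv/= x0 (le_trans xc).
  apply: (integrable_patch _ _ _).2.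
  apply: eq_integrable ix; first exact: measurableT.
  move=> y _ /=; rewrite /W patch_setX patchE mem_set; first by reflexivity.
  by rewrite /= in_itv/= x0.
move: FG; rewrite EF GE -Rintegral_mkcond.
have -> : \int[mu]_(y in `[s, t]) - AB y = - \int[mu]_(y in `[s, t]) AB y.
  rewrite -mulN1r -RintegralZl; [|exact: measurable_itv|exact: iAB].
  by apply: eq_Rintegral => y _; rewrite mulN1r.
by move=> <-; rewrite addrC subrK.
Qed.

(** * Nonnegative densities and concentration at the upper end point *)

Lemma ae_eq_Rintegral (d : measure_display) (T : measurableType d)
    (R : realType) (m : {measure set T -> \bar R}) (D : set T) (f g : T -> R) :
  measurable D -> measurable_fun D f -> measurable_fun D g ->
  {ae m, forall x, D x -> f x = g x} ->
  \int[m]_(x in D) f x = \int[m]_(x in D) g x.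
Proof.
move=> mD mf mg fg; congr fine; apply: ae_eq_integral => //.
- exact/measurable_EFinP.
- exact/measurable_EFinP.
have aeF : Filter (almost_everywhere m) by exact: ae_filter_ringOfSetsType.
by move: fg; apply: filterS => x + Dx => ->.
Qed.

Lemma ae_ge0_Rintegral_norm (d : measure_display) (T : measurableType d)
    (R : realType) (m : {measure set T -> \bar R}) (D : set T) (f : T -> R) :
  measurable D -> measurable_fun D f -> {ae m, forall x, D x -> 0 <= f x} ->
  \int[m]_(x in D) f x = \int[m]_(x in D) `|f x|.
Proof.
move=> mD mf f0; apply: ae_eq_Rintegral => //; first exact: measurableT_comp.
have aeF : Filter (almost_everywhere m) by exact: ae_filter_ringOfSetsType.
by move: f0; apply: filterS => x + Dx => /(_ Dx) fx; rewrite ger0_norm.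
Qed.

Lemma ae_ge0_Rintegral_norm_itv (R : realType) (a b c d : R) (f : R -> R) :
  a <= c -> d <= b -> mu.-integrable `[a, b] (EFin \o f) ->
  {ae mu, forall x : R, x \in `[a, b] -> 0 <= f x} ->
  \int[mu]_(x in `[c, d]) f x = \int[mu]_(x in `[c, d]) `|f x|.
Proof.
move=> ac db fi f0.
have ci : mu.-integrable `[c, d] (EFin \o f) by exact: integrable_sub_itv fi.
have mc := measurable_int _ ci.
apply: ae_ge0_Rintegral_norm; first exact: measurable_itv.
  exact/measurable_EFinP.
move: f0; apply: filterS => x + xc; apply; move: xc.
by rewrite /= !in_itv/= => /andP[/(le_trans ac)-> /le_trans->].
Qed.

(** Otherwise f vanishes almost everywhere on [c,b], and the open half-line above
    c is a neighbourhood of b that excludes b from the support. *)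
Lemma ess_support_tail_gt0 (R : realType) (a b c : R) (f : R -> R) :
  a <= c < b -> mu.-integrable `[a, b] (EFin \o f) ->
  {ae mu, forall x : R, x \in `[a, b] -> 0 <= f x} ->
  ess_support `[a, b] f b -> 0 < \int[mu]_(x in `[c, b]) f x.
Proof.
move=> /andP[ac cb] fi f0 [_ fb].
have ci : mu.-integrable `[c, b] (EFin \o f) by exact: integrable_sub_itv fi.
have mc : measurable_fun `[c, b] (EFin \o f) by exact: measurable_int ci.
rewrite (ae_ge0_Rintegral_norm_itv ac (lexx b) fi f0).
rewrite lt_neqAle Rintegral_ge0 ?andbT//.
apply/eqP => f00; apply: fb.
have nc := integrable_norm ci.
have fE : (\int[mu]_(x in `[c, b]) `|(EFin \o f) x|)%E = 0%E.
  rewrite [LHS](_ : _ = (\int[mu]_(x in `[c, b]) `|f x|%:E)%E) //.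
  rewrite -[LHS]fineK; last exact: integrable_fin_num.
  by congr EFin; exact: (esym f00).
have [+ _] := ae_eq_integral_abs mu (measurable_itv `[c, b]) mc.
move=> /(_ fE) f0E; exists `]c, +oo[%classic; last by rewrite /= in_itv/= cb.
split; first exact: interval_open.
move: f0E; apply: filterS => x /= + xa xc.
move: xa xc; rewrite !in_itv/= => /andP[_ xb]; rewrite andbT => cx.
by rewrite (ltW cx) xb => /(_ isT)[].
Qed.

(** As the mass is 1, the error is the integral of (g - g(b)) f.  Above some
    c < b the factor g - g(b) is small by continuity; below c it is bounded by
    the oscillation K of g, while the mass there tends to 0. *)
Lemma concentration_weak_star (R : realType) (b : R) (f : R -> R -> R) :
  0 < b ->
  (forall t, 0 <= t -> mu.-integrable `[0, b] (EFin \o (f^~ t))) ->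
  (forall t, 0 <= t -> {ae mu, forall x : R, x \in `[0, b] -> 0 <= f x t}) ->
  (forall t, 0 <= t -> \int[mu]_(x in `[0, b]) f x t = 1) ->
  (forall c, 0 <= c < b -> \int[mu]_(x in `[0, c]) f x t @[t --> +oo] --> 0) ->
  weak_star_cvg b f (@dirac _ (measurableTypeR R) b R).
Proof.
move=> b0 fi f0 f1 fc g cg.
have bb : b \in `[0, b] by rewrite in_itv/= (ltW b0) lexx.
have mg : measurable_fun `[0, b] g.
  by apply: subspace_continuous_measurable_fun.
have mgE : measurable_fun `[0, b] (EFin \o g) by exact/measurable_EFinP.
have -> : \int[@dirac _ (measurableTypeR R) b R]_(z in `[0, b]) g z = g b.
  rewrite /Rintegral integral_dirac; [|exact: measurable_itv|exact: mgE].
  by rewrite diracE mem_set//= mul1r.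
have [xM xMb gM] := EVT_max (ltW b0) cg.
have [xm xmb gm] := EVT_min (ltW b0) cg.
pose K := g xM - g xm.
have K0 : 0 <= K by rewrite subr_ge0 gM.
have gK x : x \in `[0, b] -> `|g x - g b| <= K.
  move=> xb; rewrite ler_norml /K; apply/andP.
  have := gM _ xb; have := gm _ xb; have := gM _ bb; have := gm _ bb.
  by split; lra.
have [_ _ gb] := (continuous_within_itvP _ b0).1 cg.
apply/cvgrPdist_le => e e0.
have e2 : 0 < e / 2 by exact: divr_gt0.
move/cvgrPdist_le : gb => /(_ _ e2)[d /= d0 dP].
pose c := Num.max 0 (b - d / 2).
have c0b : 0 <= c < b.
  rewrite le_max lexx/= gt_max b0/=; lra.
have [c0 cb] := andP c0b.
have cP x : x \in `[0, b] -> c < x -> `|g x - g b| <= e / 2.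
  rewrite in_itv/= => /andP[_ xb] cx.
  have [->|xnb] := eqVneq x b; first by rewrite subrr normr0 ltW.
  rewrite distrC; apply: dP; last by rewrite lt_neqAle xnb.
  rewrite /= gtr0_norm ?subr_gt0 ?lt_neqAle ?xnb//.
  have : b - d / 2 <= c by rewrite le_max lexx orbT.
  by lra.
(* K + 1 rather than K, as g may be constant. *)
pose e3 := e / (2 * (K + 1)).
have e30 : 0 < e3 by rewrite divr_gt0// mulr_gt0// ltr_wpDl.
have /cvgrPdist_le/(_ _ e30) Kc := fc c c0b.
near=> t.
have t0 : 0 <= t by near: t; exact: nbhs_pinfty_ge.
have Xc : `|0 - \int[mu]_(x in `[0, c]) f x t| <= e3 by near: t; exact: Kc.
have fit := fi _ t0; have fct : mu.-integrable `[0, c] (EFin \o (f^~ t)).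
  exact: integrable_sub_itv (lexx _) (ltW cb) fit.
have mft : measurable_fun `[0, b] (f^~ t).
  by apply/measurable_EFinP; exact: measurable_int fit.
have ft0 := f0 _ t0.
pose h x := (g x - g b) * f x t.
have mh : measurable_fun `[0, b] h.
  by apply: measurable_funM => //; exact: measurable_funB.
have hK x : x \in `[0, b] -> `|h x| <= K * `|f x t|.
  by move=> xb; rewrite /h normrM ler_wpM2r// gK.
have iKf : mu.-integrable `[0, b] (EFin \o (fun x => K * f x t)).
  exact: (integrableZl _ K fit).
have ih : mu.-integrable `[0, b] (EFin \o h).
  apply: le_integrable iKf => //; first exact/measurable_EFinP.
  by move=> x xb /=; rewrite lee_fin [leRHS]normrM (ger0_norm K0); exact: hK.
have igbf : mu.-integrable `[0, b] (EFin \o (fun x => g b * f x t)).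
  exact: (integrableZl _ (g b) fit).
have -> : \int[mu]_(z in `[0, b]) (g z * f z t) = \int[mu]_(x in `[0, b]) h x + g b.
  rewrite -[X in _ + X]mulr1 -(f1 _ t0) -RintegralZl// -RintegralD//.
  by apply: eq_Rintegral => x _; rewrite /h; ring.
rewrite opprD addrCA subrr addr0 normrN.
have nf := integrable_norm fit; have nfc := integrable_norm fct.
have incl : `[0, c]%classic `<=` `[0, b]%classic.
  by apply: subset_itvl; rewrite bnd_simp ltW.
have i1 : mu.-integrable `[0, b] (EFin \o (fun x => e / 2 * `|f x t|)).
  exact: (integrableZl _ (e / 2) nf).
have i2' : mu.-integrable `[0, b] (EFin \o ((fun x => `|f x t|) \_ `[0, c])).
  rewrite -restrict_EFin; apply/integrable_restrict => //.
  by rewrite setIidr.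
have i2 : mu.-integrable `[0, b]
    (EFin \o (fun x => K * ((fun x => `|f x t|) \_ `[0, c]) x)).
  exact: (integrableZl _ K i2').
apply: (le_trans (le_normr_Rintegral _ ih)) => //.
apply: (@le_trans _ _ (\int[mu]_(x in `[0, b])
    (e / 2 * `|f x t| + K * ((fun x => `|f x t|) \_ `[0, c]) x))).
  apply: le_Rintegral => //; first exact: integrable_norm.
    exact: (integrableD _ i1 i2).
  move=> x xb; rewrite patchE; case: ifPn => [_|xc].
    by rewrite ler_wpDl ?hK// mulr_ge0// ltW.
  rewrite mulr0 addr0 /h normrM ler_wpM2r// cP//.
  rewrite ltNge; apply: contra xc => xc; rewrite inE/=.
  by move: xb; rewrite /= !in_itv/= xc => /andP[->].
rewrite RintegralD// RintegralZl// RintegralZl// -Rintegral_mkcondr setIidr//.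
rewrite -(ae_ge0_Rintegral_norm_itv (lexx _) (lexx _) fit ft0) (f1 _ t0) mulr1.
rewrite -(ae_ge0_Rintegral_norm_itv (lexx _) (ltW cb) fit ft0).
move: Xc; rewrite sub0r normrN; set X := Rintegral _ _ _ => Xc.
have XK : K * X <= (K + 1) * e3.
  apply: (@le_trans _ _ ((K + 1) * `|X|)).
    apply: (le_trans (ler_wpM2l K0 (ler_norm X))).
    by rewrite ler_wpM2r// lerDl.
  by rewrite ler_wpM2l// addr_ge0.
have eE : e = e / 2 + (K + 1) * e3.
  by rewrite /e3; field; rewrite gt_eqF// ltr_wpDl.
by rewrite [leRHS]eE lerD2l.
Unshelve. all: by end_near.
Qed.

(** * Decay of the mass below a level *)

(** Above the level zbar there is only a null set to exchange mass with. *)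
Lemma total_mass (R : realType) (zbar : R) (alpha f : R -> R -> R)
    (f0 : R -> R) (t : R) :
  0 < zbar -> bounded_density zbar f0 -> learning_function zbar alpha ->
  is_solution zbar alpha f f0 -> 0 <= t ->
  \int[mu]_(x in `[0, zbar]) f x t = 1.
Proof.
move=> z0 bd la sol t0.
have zz : 0 <= zbar <= zbar by rewrite (ltW z0) lexx.
have tt : 0 <= (0 : R) <= t by rewrite lexx.
have [_ ->] := mass_balance la sol zz tt.
have -> : \int[mu]_(y in `[0, t]) ((\int[mu]_(x in `[0, zbar]) (alpha x y * f x y)) *
    \int[mu]_(x in `[zbar, zbar]) f x y) = 0.
  under eq_Rintegral do rewrite set_itv1 Rintegral_set1 mulr0.
  by rewrite Rintegral_cst// mul0r.
rewrite subr0.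
have mf0 : measurable_fun `[0, zbar] f0.
  apply/measurable_restrictT; first exact: measurable_itv.
  by move: (bd_Linfty bd); rewrite inE => /andP[/[!inE]/=].
have fit := sol_integrable sol (lexx 0).
have mft := measurable_int _ fit.
transitivity (\int[mu]_(x in `[0, zbar]) f0 x); last by rewrite /Rintegral bd_mass.
have init := sol_init sol.
apply: ae_eq_Rintegral => //; first exact/measurable_EFinP.
Qed.

(** The mass X below c only decreases and the mass B above c only grows.  Hence
    the flux A B, where A >= alow X, is at least alow X(t) B(0) at any time
    before t; the balance on [0,t] then bounds X(t). *)
Lemma mass_below_decay (R : realType) (zbar : R) (alpha f : R -> R -> R)
    (f0 : R -> R) (alow c t : R) :
  learning_function zbar alpha -> is_solution zbar alpha f f0 ->
  (forall t, 0 <= t -> {ae mu, forall z : R, z \in `[0, zbar] -> 0 <= f z t}) ->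
  (forall t, 0 <= t -> \int[mu]_(x in `[0, zbar]) f x t = 1) ->
  0 <= alow ->
  (forall z t : R, z \in `[0, zbar] -> 0 <= t -> alow <= alpha z t) ->
  0 <= c <= zbar -> 0 <= t ->
  0 <= \int[mu]_(x in `[0, c]) f x t /\
  (\int[mu]_(x in `[0, c]) f x t) *
    (1 + alow * (\int[mu]_(x in `[c, zbar]) f x 0) * t) <= 1.
Proof.
move=> la sol f_ge0 f1 alow0 alowP c0z t0.
have [c0 cz] := andP c0z.
pose X s := \int[mu]_(x in `[0, c]) f x s.
pose B s := \int[mu]_(x in `[c, zbar]) f x s.
pose A s := \int[mu]_(x in `[0, c]) (alpha x s * f x s).
have X0 s : 0 <= s -> 0 <= X s.
  move=> s0; have fs := sol_integrable sol s0.
  rewrite /X (ae_ge0_Rintegral_norm_itv (lexx _) cz fs (f_ge0 s s0)).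
  exact: Rintegral_ge0.
have B0 s : 0 <= s -> 0 <= B s.
  move=> s0; have fs := sol_integrable sol s0.
  rewrite /B (ae_ge0_Rintegral_norm_itv c0 (lexx _) fs (f_ge0 s s0)).
  exact: Rintegral_ge0.
have XB s : 0 <= s -> X s + B s = 1.
  move=> s0; rewrite -(f1 s s0).
  have ci : mu.-integrable `]c, zbar] (EFin \o (f^~ s)).
    apply: integrableS (sol_integrable sol s0) => //.
    by apply: subset_itvr; rewrite bnd_simp.
  have fs := sol_integrable sol s0.
  have := @Rintegral_itvB R (f^~ s) (BLeft 0) (BRight zbar) c fs.
  rewrite !bnd_simp => /(_ c0 cz); rewrite Rintegral_itv_obnd_cbnd// -/(B s) -/(X s).
  by move=> <-; rewrite addrC subrK.
have AX s : 0 <= s -> alow * X s <= A s.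
  move=> s0; have fs := sol_integrable sol s0.
  have fcs : mu.-integrable `[0, c] (EFin \o (f^~ s)).
    exact: integrable_sub_itv (lexx _) cz fs.
  have afs := integrable_learning la s0 fs.
  have afcs := integrable_sub_itv (lexx _) cz afs.
  have af0 : {ae mu, forall x : R, x \in `[0, zbar] -> 0 <= alpha x s * f x s}.
    have := f_ge0 s s0; apply: filterS => x + xz => /(_ xz) fx.
    by rewrite mulr_ge0// (le_trans alow0 (alowP _ _ xz s0)).
  rewrite /A (ae_ge0_Rintegral_norm_itv (lexx _) cz afs af0).
  rewrite /X (ae_ge0_Rintegral_norm_itv (lexx _) cz fs (f_ge0 s s0)).
  have nf := integrable_norm fcs.
  rewrite -RintegralZl//; apply: le_Rintegral => //.
  - exact: (integrableZl _ alow nf).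
  - exact: integrable_norm.
  - move=> x xc; have xz : x \in `[0, zbar].
      move: xc; rewrite /= !in_itv/= => /andP[-> /le_trans->//].
    rewrite normrM ler_wpM2r//.
    exact: le_trans (alowP _ _ xz s0) (ler_norm _).
have A0 s : 0 <= s -> 0 <= A s.
  by move=> s0; apply: le_trans (AX s s0); rewrite mulr_ge0// X0.
have balance s r : 0 <= s <= r ->
    mu.-integrable `[s, r] (EFin \o (fun y => A y * B y)) /\
    X r = X s - \int[mu]_(y in `[s, r]) (A y * B y).
  exact: mass_balance la sol c0z.
have Xni s r : 0 <= s <= r -> X r <= X s.
  move=> sr; have [_ ->] := balance s r sr.
  rewrite gerBl; apply: Rintegral_ge0 => y; rewrite /= in_itv/= => /andP[sy _].
  have y0 : 0 <= y by move/andP: sr => [s0 _]; exact: le_trans sy.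
  by rewrite mulr_ge0 ?A0 ?B0.
split; first exact: X0.
rewrite -/(X t) -/(B 0).
have tt : 0 <= (0 : R) <= t by rewrite lexx.
have [iAB XE] := balance 0 t tt.
have low : alow * X t * B 0 * t <= \int[mu]_(y in `[0, t]) (A y * B y).
  have -> : alow * X t * B 0 * t = \int[mu]_(y in `[0, t]) (alow * X t * B 0).
    rewrite Rintegral_cst; last exact: measurable_itv.
    rewrite [X in fine X](lebesgue_measure_itv `[0, t])/= lte_fin.
    by congr (_ * _); case: ltgtP t0 => //= _ _; rewrite subr0.
  apply: le_Rintegral => //.
    apply: continuous_compact_integrable; first exact: segment_compact.
    by apply: continuous_subspaceT => y; exact: cvg_cst.
  move=> y; rewrite /= in_itv/= => /andP[y0 yt].
  have yyt : 0 <= y <= t by rewrite y0.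
  have y00 : 0 <= (0 : R) <= y by rewrite lexx.
  rewrite ler_pM// ?mulr_ge0 ?X0 ?B0//.
    by apply: le_trans (AX y y0); rewrite ler_wpM2l// Xni.
  have := XB _ (lexx 0); have := XB _ y0; have := Xni _ _ y00; lra.
have := XB _ (lexx 0); have := B0 _ (lexx 0).
have -> : X t * (1 + alow * B 0 * t) = X t + alow * X t * B 0 * t by ring.
lra.
Qed.

Theorem theorem3p3 (R : realType) (zbar : R) (f0 : R -> R)
    (alpha f : R -> R -> R) (alow : R)
    (zbar_gt0 : 0 < zbar)
    (f0_density : bounded_density zbar f0)
    (alpha_learning : learning_function zbar alpha)
    (f_ge0 : forall t : R, 0 <= t ->
       {ae mu, forall z : R, z \in `[0, zbar] -> 0 <= f z t})
    (f_solution : is_solution zbar alpha f f0)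
    (alow_gt0 : 0 < alow)
    (alpha_ge : forall z t : R, z \in `[0, zbar] -> 0 <= t -> alow <= alpha z t)
    (zbar_supp : forall t : R, 0 <= t ->
       ess_support `[0, zbar] (fun z => f z t) zbar) :
  weak_star_cvg zbar f (@dirac _ (measurableTypeR R) zbar R).
Proof.
have mass1 t : 0 <= t -> \int[mu]_(x in `[0, zbar]) f x t = 1.
  exact: (total_mass zbar_gt0 f0_density alpha_learning f_solution).
apply: concentration_weak_star => //.
  by move=> t t0; exact: (sol_integrable f_solution t0).
move=> c c0z; have [c0 cz] := andP c0z.
have m0 := ess_support_tail_gt0 c0z (sol_integrable f_solution (lexx 0))
  (f_ge0 0 (lexx 0)) (zbar_supp 0 (lexx 0)).
pose k := alow * \int[mu]_(x in `[c, zbar]) f x 0.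
have k0 : 0 < k by exact: mulr_gt0.
apply/cvgrPdist_le => e e0.
near=> t.
have t0 : 0 < t by near: t; exact: nbhs_pinfty_gt.
have te : (k * e)^-1 <= t by near: t; apply: nbhs_pinfty_ge; rewrite num_real.
have c0z' : 0 <= c <= zbar by rewrite c0 ltW.
have [X0 Xt] := mass_below_decay alpha_learning f_solution f_ge0 mass1
  (ltW alow_gt0) alpha_ge c0z' (ltW t0).
rewrite sub0r normrN ger0_norm//.
move: X0 Xt; rewrite -/k; set X := Rintegral _ _ _ => X0 Xt.
have ekt : 1 <= e * (k * t).
  by move: te; rewrite -div1r ler_pdivrMr ?mulr_gt0//; lra.
have : X * (k * t) <= e * (k * t).
  by apply: le_trans ekt; apply: le_trans Xt; rewrite ler_wpM2l// lerDr.
by rewrite ler_pM2r// mulr_gt0.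
Unshelve. all: by end_near.
Qed.
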